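(* Let $X$ and $Y$ be Banach spaces and $G\in\mathcal{L}(X,Y)$. Then $G$ is a Daugavet center if and only if $G$ is a Lipschitz Daugavet center.
   Context: $X,Y$ are Banach spaces over the same field (real or complex). $\mathcal{L}(X,Y)$ is the space of bounded linear operators. $G\in\mathcal{L}(X,Y)$ is a Daugavet center if $\|G+R\|=\|G\|+\|R\|$ for every rank-one operator $R\in\mathcal{L}(X,Y)$. $\mathrm{Lip}_0(X,Y)$ is the space of Lipschitz maps $T:X\to Y$ with $T(0)=0$, with norm $\|T\|_L=\sup\{\|Tu-Tv\|/\|u-v\|: u\ne v\}$. A map $G\in\mathrm{Lip}_0(X,Y)$ is a Lipschitz Daugavet center if $\|G+T\|_L=\|G\|_L+\|T\|_L$ for every rank-one Lipschitz map $T\in\mathrm{Lip}_0(X,Y)$, where rank-one means that the range of $T$ lies in a one-dimensional subspace of $Y$. *)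

(* Defs.v *)
From HB Require Import structures.
From mathcomp Require Import all_boot all_order all_algebra.
From mathcomp Require Export complex.
From mathcomp Require Import all_classical all_reals all_analysis.

Set Implicit Arguments.
Unset Strict Implicit.
Unset Printing Implicit Defensive.

Import Order.TTheory GRing.Theory Num.Theory.
Import numFieldNormedType.Exports.

Local Open Scope classical_set_scope.
Local Open Scope ring_scope.

(* Norms of a [normedModType K] are valued in [K]. When [K] is [R[i]], the
   order on [K] is the partial one ([x <= y] iff [y - x] is a nonnegative real),
   and [supremum 0 A] is, for a nonempty [A] of nonnegative reals bounded above,
   the usual supremum of [A] seen in [K]; when [K] is a [realType] it is
   [sup A]. On the empty set (e.g. when [X] is the zero space) it is [0]. *)

Definition real_or_complex (R : realType) (K : numFieldType) : Prop :=
  K = R :> numFieldType \/ K = R[i] :> numFieldType.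

Section DaugavetCenters.
Variables (K : numFieldType) (X Y : completeNormedModType K).

Definition bounded_operator (f : {linear X -> Y}) : Prop :=
  bounded_near f (nbhs (0 : X)).

Definition opnorm (f : {linear X -> Y}) : K :=
  supremum 0 [set `|f x| | x in [set x : X | `|x| <= 1]].

Definition line (y : Y) : set Y := [set k *: y | k in [set: K]].

Definition rank_one (f : {linear X -> Y}) : Prop :=
  exists2 y : Y, y != 0 & range f = line y.

Definition daugavet_center (G : {linear X -> Y}) : Prop :=
  bounded_operator G /\
  forall T : {linear X -> Y}, bounded_operator T -> rank_one T ->
    opnorm (G \+ T) = opnorm G + opnorm T.

Definition Lip0 : set (X -> Y) := [set f : X -> Y | lipschitz f /\ f 0 = 0].

Definition lipnorm (f : X -> Y) : K :=
  supremum 0 [set `|f uv.1 - f uv.2| / `|uv.1 - uv.2|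
             | uv in [set uv : X * X | uv.1 != uv.2]].

(* The line may be any one containing the range, so the zero map qualifies as
   soon as [Y] is not the zero space. *)
Definition lip_rank_one (f : X -> Y) : Prop :=
  exists2 y : Y, y != 0 & range f `<=` line y.

Definition lip_daugavet_center (G : X -> Y) : Prop :=
  Lip0 G /\
  forall T : X -> Y, Lip0 T -> lip_rank_one T ->
    lipnorm (G \+ T) = lipnorm G + lipnorm T.

End DaugavetCenters.

(* Main.v *)
From HB Require Import structures.
Require Import Defs.
From mathcomp Require Import all_boot all_order all_algebra.
From mathcomp Require Import all_classical all_reals all_analysis.
From mathcomp Require Import lra ring.

(* Let T = h(.) y with h a 1-Lipschitz scalar function. The supremum over w and
   t > 0 of Re (h (w + t z) - h w) / t is a sublinear functional of z bounded by
   |z|; by Hahn-Banach it dominates a real-linear functional which is at least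
   Re (h u - h v) at u - v, hence has norm close to 1 for suitable u and v. It
   is the real part of a K-linear f, and the linear Daugavet equation for
   G + f(.) y yields x in the unit ball with f x close to 1 and |G x + y| close
   to |G| + |y|. As f is dominated by the slopes of h, some increment of h in the
   direction x has slope close to 1, and there the increment of G + T almost
   attains |G| + |T|.

   Hahn-Banach is obtained from the fact that a sublinear functional which is
   minimal among sublinear functionals is linear. *)

Set Implicit Arguments.
Unset Strict Implicit.
Unset Printing Implicit Defensive.

Import Order.TTheory GRing.Theory Num.Theory.
Import numFieldNormedType.Exports.

Local Open Scope classical_set_scope.
Local Open Scope ring_scope.

(** * Sublinear functionals and the Hahn-Banach theorem *)

Section HahnBanach.
Context {R : realType} {V : lmodType R}.
Implicit Types (p q : V -> R) (x y : V).

Definition sublinear p :=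
  (forall x y, p (x + y) <= p x + p y) /\
  (forall t x, 0 <= t -> p (t *: x) = t * p x).

Lemma sublinear0 p : sublinear p -> p 0 = 0.
Proof. by case=> _ hp; rewrite -(scale0r 0) hp// mul0r. Qed.

Lemma sublinear_oppr_ge p x : sublinear p -> - p (- x) <= p x.
Proof.
move=> hp; have := hp.1 x (- x); rewrite subrr (sublinear0 hp); lra.
Qed.

(** One inequality suffices: applied to [t^-1] and [t *: x] it yields the reverse one. Functionals
    defined as infima or suprema give only one direction directly. *)
Lemma sublinear_pos_homo p : (forall x y, p (x + y) <= p x + p y) ->
  p 0 = 0 -> (forall t x, 0 < t -> p (t *: x) <= t * p x) -> sublinear p.
Proof.
move=> pD p0 pZ; split=> // t x; rewrite le_eqVlt => /predU1P[<-|t0].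
  by rewrite scale0r mul0r.
apply/eqP; rewrite eq_le pZ//= -ler_pdivlMl//.
have := pZ t^-1 (t *: x); rewrite invr_gt0 => /(_ t0).
by rewrite scalerA mulVf ?gt_eqF// scale1r.
Qed.

(* The largest sublinear minorant of [p] whose value at [- x0] is [- p x0]. *)
Definition directional p x0 x : R :=
  inf [set p (x + t *: x0) - t * p x0 | t in [set t | 0 <= t]].

Section directional.
Variables (p : V -> R) (x0 : V).
Hypothesis hp : sublinear p.

(** Subadditivity at [t *: x0 = (x + t *: x0) - x] gives a bound independent of [t], so the infimum
    is finite. *)
Let dir_lb x : lbound [set p (x + t *: x0) - t * p x0 | t in [set t | 0 <= t]] (- p (- x)).
Proof.
move=> _ [t /= t0 <-]; have := hp.1 (x + t *: x0) (- x).
by rewrite addrAC subrr add0r hp.2//; lra.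
Qed.

Lemma directional_le_at t x : 0 <= t ->
  directional p x0 x <= p (x + t *: x0) - t * p x0.
Proof.
move=> t0; apply: ge_inf; last by exists t.
by exists (- p (- x)); exact: dir_lb.
Qed.

Lemma directional_le x : directional p x0 x <= p x.
Proof.
by have := @directional_le_at 0 x (lexx _); rewrite scale0r addr0 mul0r subr0.
Qed.

Lemma le_directional c x :
  (forall t, 0 <= t -> c <= p (x + t *: x0) - t * p x0) ->
  c <= directional p x0 x.
Proof.
move=> h; apply: lb_le_inf => [|_ [t t0 <-]]; last exact: h.
by exists (p (x + 0 *: x0) - 0 * p x0); exists 0 => /=.
Qed.

Lemma directional_opp : directional p x0 (- x0) <= - p x0.
Proof.
have := @directional_le_at 1 (- x0) ler01.
by rewrite scale1r addNr (sublinear0 hp) mul1r sub0r.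
Qed.

(** Parameters [t] for [x] and [u] for [y] combine to [t + u] for [x + y]; for homogeneity the
    parameter [u] is rescaled to [t * u]. *)
Lemma directional_sublinear : sublinear (directional p x0).
Proof.
apply: sublinear_pos_homo => [x y| |t x t0] /=.
- rewrite -lerBlDr; apply: le_directional => t t0.
  rewrite lerBlDr -lerBlDl; apply: le_directional => u u0.
  rewrite lerBlDl; have := directional_le_at (x + y) (addr_ge0 t0 u0).
  move/le_trans; apply; rewrite scalerDl addrACA mulrDl.
  by have := hp.1 (x + t *: x0) (y + u *: x0); lra.
- apply/eqP; rewrite eq_le; apply/andP; split.
    by rewrite -[leRHS](sublinear0 hp) directional_le.
  by apply: le_directional => t t0; rewrite add0r hp.2// subrr.
- rewrite -ler_pdivrMl//; apply: le_directional => u u0.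
  rewrite ler_pdivrMl//.
  have tu0 : 0 <= t * u by rewrite mulr_ge0// ltW.
  have := directional_le_at (t *: x) tu0; move/le_trans; apply.
  by rewrite -scalerA -scalerDr (hp.2 _ _ (ltW t0)) mulrBr mulrA.
Qed.

End directional.

(** The pointwise infimum works. It is finite because p x >= - p (- x) >= - b (- x). For
    subadditivity, two members nearly optimal at [x] and at [y] are comparable, and the smaller one
    serves at both points. *)
Lemma chain_inf_sublinear (A : set (V -> R)) (b : V -> R) :
  A !=set0 -> (forall p, A p -> sublinear p) ->
  (forall p x, A p -> p x <= b x) ->
  (forall p q, A p -> A q -> (forall x, p x <= q x) \/ (forall x, q x <= p x)) ->
  exists q, sublinear q /\ forall p x, A p -> q x <= p x.
Proof.
move=> [r Ar] Asub Ab Atot; pose S x := [set p x | p in A].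
have Slb x : has_lbound (S x).
  exists (- b (- x)) => _ [p Ap <-].
  by rewrite (le_trans _ (sublinear_oppr_ge x (Asub _ Ap)))// lerN2 Ab.
have qle p x : A p -> inf (S x) <= p x.
  by move=> Ap; apply: ge_inf => //; exists p.
have leqf c x : (forall p, A p -> c <= p x) -> c <= inf (S x).
  move=> h; apply: lb_le_inf => [|_ [p Ap <-]]; last exact: h.
  by exists (r x); exists r.
exists (fun x => inf (S x)); split => //; apply: sublinear_pos_homo => [x y| |t x t0] /=.
- rewrite -lerBlDr; apply: (leqf _ _) => p Ap; rewrite lerBlDr -lerBlDl.
  apply: (leqf _ _) => q Aq; rewrite lerBlDl.
  have [pq|qp] := Atot _ _ Ap Aq.
    rewrite (le_trans (qle _ _ Ap))// (le_trans ((Asub _ Ap).1 _ _))//.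
    by rewrite lerD2l.
  rewrite (le_trans (qle _ _ Aq))// (le_trans ((Asub _ Aq).1 _ _))//.
  by rewrite lerD2r.
- apply/eqP; rewrite eq_le; apply/andP; split.
    by rewrite -[leRHS](sublinear0 (Asub _ Ar)) qle.
  by apply: (leqf _ _) => p Ap; rewrite (sublinear0 (Asub _ Ap)).
- rewrite -ler_pdivrMl//; apply: (leqf _ _) => p Ap; rewrite ler_pdivrMl//.
  by apply: (le_trans (qle _ _ Ap)); rewrite ((Asub _ Ap).2 _ _ (ltW t0)).
Qed.

Lemma sublinear_minorant_minimal p : sublinear p ->
  exists q, [/\ sublinear q, forall x, q x <= p x &
    forall q', sublinear q' -> (forall x, q' x <= q x) -> q' = q].
Proof.
move=> hp; pose T := {q | sublinear q /\ forall x, q x <= p x}.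
have extT (s t : T) : sval s = sval t -> s = t.
  by case: s t => [s hs] [t ht] /= st; subst t; congr exist; exact: Prop_irrelevance.
(* The order is reversed, so a maximal element for Zorn's lemma is a minimal minorant; [p] itself
   bounds the empty chain. *)
have [||||[q [hq qp]] qmin] := @Zorn T (fun s t => `[< forall x, sval t x <= sval s x >]).
- by move=> t; apply/asboolP.
- move=> r s t /asboolP rs /asboolP st; apply/asboolP => x.
  exact: le_trans (st x) (rs x).
- move=> s t /asboolP st /asboolP ts; apply: extT; apply/funext => x.
  by apply/eqP; rewrite eq_le st ts.
- move=> A Atot; have [[s As]|A0] := pselect (A !=set0); last first.
    by exists (exist _ p (conj hp (fun=> lexx _))) => s As; case: A0; exists s.
  have [||||q [hq qA]] := @chain_inf_sublinear [set sval s | s in A] p.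
  + by exists (sval s); exists s.
  + by move=> _ [u _ <-]; case: (svalP u).
  + by move=> _ x [u _ <-]; case: (svalP u).
  + move=> _ _ [u Au <-] [v Av <-].
    by have [/asboolP|/asboolP] := Atot u v Au Av; [right|left].
  have qp x : q x <= p x.
    by apply: (le_trans (qA (sval s) x _)); [exists s|case: (svalP s)].
  exists (exist _ q (conj hq qp)) => u Au; apply/asboolP => x /=.
  by apply: qA; exists u.
exists q; split=> // q' hq' q'q.
have q'p x : q' x <= p x by exact: le_trans (q'q x) (qp x).
by have /(congr1 sval) := qmin (exist _ q' (conj hq' q'p)) (asboolT q'q).
Qed.

(* A minimal sublinear functional equals all its [directional] minorants, which
   forces it to be odd, hence additive. *)
Lemma sublinear_minorant_linear p : sublinear p ->
  exists l, (forall a x y, l (a *: x + y) = a * l x + l y) /\ forall x, l x <= p x.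
Proof.
move=> /sublinear_minorant_minimal[l [hl lp lmin]]; exists l; split=> //.
have lN x : l (- x) = - l x.
  apply/eqP; rewrite eq_le; apply/andP; split.
    rewrite -{1}(lmin _ (directional_sublinear x hl) (directional_le x hl)).
    exact: directional_opp.
  by rewrite lerNl -{2}[x]opprK; have := sublinear_oppr_ge (- x) hl; rewrite opprK; lra.
have lD x y : l (x + y) = l x + l y.
  apply/eqP; rewrite eq_le hl.1 /=.
  by have := hl.1 (- x) (- y); rewrite -opprD !lN; lra.
move=> a x y; rewrite lD; congr (_ + _).
have [a0|a0] := leP 0 a; first exact: hl.2.
have na0 : 0 <= - a by rewrite oppr_ge0 ltW.
by rewrite -[a in LHS]opprK scaleNr lN hl.2// mulNr opprK.
Qed.

(** A linear minorant of [directional p x0], rather than of [p], satisfies l (- x0) <= - p x0, which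
    forces equality at [x0]. *)
Lemma Hahn_Banach p x0 : sublinear p ->
  exists l, [/\ forall a x y, l (a *: x + y) = a * l x + l y,
    forall x, l x <= p x & l x0 = p x0].
Proof.
move=> hp; have [l [llin lp]] := sublinear_minorant_linear (directional_sublinear x0 hp).
have lle x : l x <= p x by exact: le_trans (lp x) (directional_le x0 hp x).
exists l; split=> //; apply/eqP; rewrite eq_le lle/=.
have l0 : l 0 = 0 by have := llin 1 0 0; rewrite scaler0 addr0; lra.
have := llin (-1) x0 0; rewrite l0 addr0 scaleN1r.
by have := le_trans (lp _) (directional_opp x0 hp); lra.
Qed.

End HahnBanach.

(** * Slopes of a Lipschitz function and their linear minorants *)

Section Slope.
Context {R : realType} {V : lmodType R}.
Variables (h N : V -> R).
Hypothesis hN : forall w z, h (w + z) - h w <= N z.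
Hypothesis NZ : forall t z, 0 < t -> N (t *: z) = t * N z.

Definition slope z : R :=
  sup [set (h (w.1 + w.2 *: z) - h w.1) / w.2 | w in [set w : V * R | 0 < w.2]].

Let slopes_ub z : ubound
  [set (h (w.1 + w.2 *: z) - h w.1) / w.2 | w in [set w : V * R | 0 < w.2]] (N z).
Proof.
by move=> _ [[w t] /= t0 <-]; rewrite ler_pdivrMr// mulrC -NZ.
Qed.

Lemma slope_le c z :
  (forall w t, 0 < t -> h (w + t *: z) - h w <= c * t) -> slope z <= c.
Proof.
move=> hc; apply: ge_sup => [|_ [[w t] /= t0 <-]].
  by exists ((h (0 + 1 *: z) - h 0) / 1); exists (0, 1) => //=.
by rewrite ler_pdivrMr// hc.
Qed.

Lemma slope_le_norm z : slope z <= N z.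
Proof.
by apply: slope_le => w t t0; apply: (le_trans (hN _ _)); rewrite NZ// mulrC.
Qed.

Lemma increment_le_slope w t z : 0 < t -> h (w + t *: z) - h w <= slope z * t.
Proof.
move=> t0; rewrite -ler_pdivrMr//; apply: ub_le_sup; last by exists (w, t).
by exists (N z); exact: slopes_ub.
Qed.

Lemma slope_gt c z : c < slope z ->
  exists w t, 0 < t /\ c * t < h (w + t *: z) - h w.
Proof.
apply: contraPP => nc; apply/negP; rewrite -leNgt; apply: slope_le => w t t0.
by rewrite leNgt; apply/negP => ct; apply: nc; exists w, t.
Qed.

(** An increment along [t *: (x + y)] splits into one along [t *: x] from [w] and one along [t *: y]
    from [w + t *: x]; the second is controlled because the supremum runs over all base points. *)
Lemma slope_sublinear : sublinear slope.
Proof.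
apply: sublinear_pos_homo => [x y| |t x t0] /=.
- apply: slope_le => w t t0.
  have h1 := increment_le_slope w x t0.
  have h2 := increment_le_slope (w + t *: x) y t0.
  rewrite scalerDr addrA mulrDl; lra.
- apply/eqP; rewrite eq_le; apply/andP; split.
    by apply: slope_le => w t t0; rewrite scaler0 addr0 subrr mul0r.
  by have := increment_le_slope 0 0 (@ltr01 R); rewrite scaler0 addr0 subrr mulr1.
- apply: slope_le => w u u0; rewrite scalerA.
  have := increment_le_slope w x (mulr_gt0 u0 t0); move/le_trans; apply.
  by rewrite mulrA mulrAC [_ * t]mulrC.
Qed.

(** Hahn-Banach at [u - v], where the base point [v] and step 1 show that the slope is at least
    [h u - h v]. Domination by the slope turns a large value of [l] into an actual increment of
    [h]. *)
Lemma linear_slope u v : exists l : V -> R,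
  [/\ forall a x y, l (a *: x + y) = a * l x + l y,
      forall x, l x <= N x,
      h u - h v <= l (u - v) &
      forall c x, c < l x -> exists w t, 0 < t /\ c * t < h (w + t *: x) - h w].
Proof.
have [l [llin ls luv]] := Hahn_Banach (u - v) slope_sublinear.
exists l; split=> //.
- by move=> x; exact: le_trans (ls x) (slope_le_norm x).
- rewrite luv.
  by have := increment_le_slope v (u - v) ltr01; rewrite scale1r mulr1 subrKC.
- by move=> c x cl; apply: slope_gt; exact: lt_le_trans cl (ls x).
Qed.

End Slope.

(** * Real and complex scalars treated together *)

Definition restrict_scalars (R K : nzRingType) (e : {rmorphism R -> K})
  (V : lmodType K) : Type := V.

Section RestrictScalars.
Variables (R K : nzRingType) (e : {rmorphism R -> K}) (V : lmodType K).

HB.instance Definition _ := GRing.Zmodule.on (restrict_scalars e V).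

(** The alias [restrict_scalars e V] keeps this action of [R] apart from the action of [K] carried
    by [V] itself. *)
Definition restricted_scale (r : R) (v : restrict_scalars e V) :
  restrict_scalars e V := e r *: (v : V).

Let scaleA a b v : restricted_scale a (restricted_scale b v) = restricted_scale (a * b) v.
Proof. by rewrite /restricted_scale scalerA rmorphM. Qed.

Let scale1 : left_id 1 restricted_scale.
Proof. by move=> v; rewrite /restricted_scale rmorph1 scale1r. Qed.

Let scaleDr : right_distributive restricted_scale +%R.
Proof. by move=> r u v; rewrite /restricted_scale scalerDr. Qed.

Let scaleDl v : {morph restricted_scale^~ v : a b / a + b}.
Proof. by move=> a b; rewrite /restricted_scale rmorphD scalerDl. Qed.

HB.instance Definition _ := GRing.Zmodule_isLmodule.Build R (restrict_scalars e V)
  scaleA scale1 scaleDr scaleDl.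
End RestrictScalars.

(* What the proof uses of the scalar field: a copy of [R] in [K], real parts,
   and the reconstruction of a [K]-linear form from its real part. *)
Record real_scalars (R : realType) (K : numFieldType) (emb : {rmorphism R -> K})
    (re : K -> R) : Prop := RealScalars {
  reD : forall a b, re (a + b) = re a + re b;
  reZ : forall r a, re (emb r * a) = r * re a;
  embK : cancel emb re;
  emb_le : {mono emb : r s / r <= s};
  emb_re : forall a, 0 <= a -> emb (re a) = a;
  re_le_norm : forall a, emb (re a) <= `|a|;
  norm_sub1_le : forall a, `|a| <= 1 -> `|a - 1| ^+ 2 <= emb (2 * (1 - re a));
  complexify : forall (V : lmodType K) (l : V -> R),
    (forall r u v, l (emb r *: u + v) = r * l u + l v) ->
    exists f : V -> K, (forall a u v, f (a *: u + v) = a * f u + f v) /\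
      forall v, re (f v) = l v }.

Lemma real_scalars_id (R : realType) :
  real_scalars (idfun : {rmorphism R -> R}) (idfun : R -> R).
Proof.
split => //=.
- exact: ler_norm.
(* Here 0 <= 1 - a <= 2, so (1 - a)^2 <= 2 (1 - a). *)
- move=> a; rewrite real_normK ?num_real// ler_norml => /andP[a1 a2]; nra.
- by move=> V l ll; exists l.
Qed.

Lemma real_scalars_complex (R : realType) :
  real_scalars (real_complex R : {rmorphism R -> R[i]}) (@complex.Re R).
Proof.
split => /=.
- by move=> [a b] [c d].
- by move=> r [a b] /=; rewrite mul0r subr0.
- by [].
- by move=> r s; rewrite lecR.
- by move=> a a0; apply: RRe_real; exact: ger0_real.
- by move=> a; apply: (le_trans _ (normc_ge_Re a)); rewrite lecR ler_norm.
(* |a - 1|^2 = |a|^2 - 2 Re a + 1, and |a|^2 <= 1. *)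
- move=> a a1; have : `|a| ^+ 2 <= 1 by rewrite expr_le1.
  rewrite -!add_Re2_Im2 lecR; case: a {a1} => a b /=.
  by rewrite lecR subr0 => ?; nra.
- move=> V l ll.
  have l0 : l 0 = 0 by have := ll 1 0 0; rewrite scaler0 addr0; lra.
  have lD u v : l (u + v) = l u + l v.
    by have := ll 1 u v; rewrite rmorph1 scale1r mul1r.
  have lZ r u : l (r%:C%C *: u) = r * l u by have := ll r u 0; rewrite !addr0 l0 addr0.
  have lN u : l (- u) = - l u by have := lD u (- u); rewrite subrr l0; lra.
  pose i : R[i] := 'i%C.
  (* The usual complexification f(v) = l(v) - i l(iv); the imaginary part is forced by Re f(iv) = -
     Im f(v). *)
  exists (fun v => (l v +i* - l (i *: v))%C); split=> // -[a b] u v /=.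
  have abE : (a +i* b)%C = a%:C%C + b%:C%C * i.
    by apply/eqP; rewrite eq_complex /=; apply/andP; split; apply/eqP; ring.
  have luE : l ((a +i* b)%C *: u) = a * l u + b * l (i *: u).
    by rewrite abE scalerDl lD -scalerA !lZ.
  have liuE : l (i *: ((a +i* b)%C *: u)) = a * l (i *: u) - b * l u.
    rewrite scalerA mulrC abE mulrDl -mulrA (sqr_i R : i * i = -1) mulrN1 scalerDl lD scaleNr lN.
    by rewrite -scalerA !lZ.
  apply/eqP; rewrite eq_complex /= scalerDr !lD luE liuE.
  by apply/andP; split; apply/eqP; ring.
Qed.

Lemma exists_phase (K : numFieldType) (a : K) :
  exists2 w : K, `|w| = 1 & w * a = `|a|.
Proof.
have [->|a0] := eqVneq a 0; first by exists 1; rewrite ?normr1// mulr0 normr0.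
exists (`|a| / a); last by rewrite divfK.
by rewrite normrM normfV normr_id divff// normr_eq0.
Qed.

(** * Lipschitz and operator norms *)

Lemma lipschitzP (K : numFieldType) (X Y : normedModType K) (f : X -> Y) :
  lipschitz f <-> exists2 M, 0 <= M & forall u v, `|f u - f v| <= M * `|u - v|.
Proof.
split=> [/pinfty_ex_gt0[M M0 fM]|[M M0 fM]].
  by exists M; [exact: ltW|move=> u v; exact: (fM (u, v) (conj I I))].
exists M; split; first exact: ger0_real.
by move=> r Mr [u v] _ /=; rewrite (le_trans (fM u v))// ler_wpM2r// ltW.
Qed.

Lemma bounded_operatorP (K : numFieldType) (X Y : completeNormedModType K)
    (f : {linear X -> Y}) :
  bounded_operator f <-> exists2 M, 0 <= M & forall x, `|f x| <= M * `|x|.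
Proof.
split=> [/linear_boundedP/pinfty_ex_gt0[M M0 fM]|[M M0 fM]].
  by exists M; [exact: ltW|].
apply/linear_boundedP; exists M; split; first exact: ger0_real.
by move=> r Mr x; apply: (le_trans (fM x)); rewrite ler_wpM2r// ltW.
Qed.

Section Norms.
Variables (R : realType) (K : numFieldType).
Variables (emb : {rmorphism R -> K}) (re : K -> R).
Hypothesis S : real_scalars emb re.

Lemma re_homo a b : 0 <= a -> a <= b -> re a <= re b.
Proof.
by move=> a0 ab; rewrite -(emb_le S) !(emb_re S)// (le_trans a0).
Qed.

(** The order of [K] may be partial, so the supremum is taken in [R] through [re] and carried back
    by [emb]. Nonnegative elements are recovered from their real parts, and an upper bound of a
    nonempty set of them is itself nonnegative. *)
Lemma supremumP (A : set K) : A !=set0 -> (forall a, A a -> 0 <= a) ->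
  has_ubound A -> supremums A (supremum 0 A).
Proof.
move=> A0 Ape [b Ab]; rewrite /supremum ifF; last first.
  by apply/negbTE/set0P.
apply: xgetPex; have [a0 Aa0] := A0.
have supB : has_sup [set re a | a in A].
  split; first by exists (re a0), a0.
  by exists (re b) => _ [a Aa <-]; rewrite re_homo ?Ab// Ape.
exists (emb (sup [set re a | a in A])); split => [a Aa|c Ac].
  rewrite -[leLHS](emb_re S) ?Ape// (emb_le S).
  by apply: sup_upper_bound => //; exists a.
rewrite -[leRHS](emb_re S); last exact: le_trans (Ape _ Aa0) (Ac _ Aa0).
rewrite (emb_le S); apply: ge_sup; first by exists (re a0), a0.
by move=> _ [a Aa <-]; rewrite re_homo ?Ac// Ape.
Qed.

Context {X Y : completeNormedModType K}.
Implicit Types (f g : X -> Y).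

Section Lipnorm.
Variable f : X -> Y.

Lemma lipnorm_le c : 0 <= c -> (forall u v, `|f u - f v| <= c * `|u - v|) ->
  lipnorm f <= c.
Proof.
move=> c0 fc; rewrite /lipnorm; set A := image _ _.
(* On the zero space there are no slopes and the supremum is 0 by default; this case rests on
   [0 <= c]. *)
have [->|/set0P A0] := eqVneq A set0; first by rewrite supremum0.
have Ac : ubound A c.
  move=> _ [[u v] /= uv <-]; rewrite ler_pdivrMr// normr_gt0 subr_eq0//.
apply: (supremumP A0 _ _).2 => //; last by exists c.
by move=> _ [w _ <-]; rewrite divr_ge0.
Qed.

Hypothesis lf : lipschitz f.

Lemma lipnormP u v : `|f u - f v| <= lipnorm f * `|u - v|.
Proof.
have [->|uv] := eqVneq u v; first by rewrite !subrr !normr0 mulr0.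
rewrite -ler_pdivrMr ?normr_gt0 ?subr_eq0//.
rewrite /lipnorm; set A := image _ _.
have AI : A (`|f u - f v| / `|u - v|) by exists (u, v).
apply: (supremumP _ _ _).1 => //; first by eexists; exact: AI.
- by move=> _ [w _ <-]; rewrite divr_ge0.
- have [M M0 fM] := (lipschitzP f).1 lf; exists M => _ [[u' v'] /= uv' <-].
  by rewrite ler_pdivrMr// normr_gt0 subr_eq0//.
Qed.

Lemma lipnorm_ge0 : 0 <= lipnorm f.
Proof.
rewrite /lipnorm; set A := image _ _.
have [->|/set0P A0] := eqVneq A set0; first by rewrite supremum0.
have [a Aa] := A0.
have Ape b : A b -> 0 <= b by move=> [w _ <-]; rewrite divr_ge0.
apply: (le_trans (Ape _ Aa)); apply: (supremumP A0 Ape _).1 => //.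
have [M M0 fM] := (lipschitzP f).1 lf; exists M => _ [[u' v'] /= uv' <-].
by rewrite ler_pdivrMr// normr_gt0 subr_eq0//.
Qed.

Lemma lt_lipnorm c : 0 <= c -> c < lipnorm f ->
  exists u v, c * `|u - v| < `|f u - f v|.
Proof.
move=> c0; apply: contraPP => nc; apply/negP; rewrite -real_leNgt ?ger0_real ?lipnorm_ge0//.
apply: lipnorm_le => // u v; rewrite real_leNgt ?ger0_real ?mulr_ge0//.
by apply/negP => h; apply: nc; exists u, v.
Qed.

End Lipnorm.

Section Opnorm.
Variable f : {linear X -> Y}.

Let ball1_0 : [set `|f x| | x in [set x : X | `|x| <= 1]] 0.
Proof. by exists 0; rewrite /= ?linear0 normr0. Qed.

Let ball1_ge0 a : [set `|f x| | x in [set x : X | `|x| <= 1]] a -> 0 <= a.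
Proof. by move=> [x _ <-]. Qed.

Lemma opnorm_le c : (forall x, `|x| <= 1 -> `|f x| <= c) -> opnorm f <= c.
Proof.
move=> fc; have fub : ubound [set `|f x| | x in [set x : X | `|x| <= 1]] c.
  by move=> _ [x /= x1 <-]; exact: fc.
by apply: (supremumP _ ball1_ge0 _).2 => //; [exists 0|exists c].
Qed.

Hypothesis bf : bounded_operator f.

Let ball1_ub : has_ubound [set `|f x| | x in [set x : X | `|x| <= 1]].
Proof.
have [M M0 fM] := (bounded_operatorP f).1 bf; exists M => _ [x /= x1 <-].
by apply: (le_trans (fM x)); rewrite ler_piMr.
Qed.

Lemma opnorm_ge0 : 0 <= opnorm f.
Proof. by apply: (supremumP _ ball1_ge0 ball1_ub).1 => //; exists 0. Qed.

Lemma opnormP x : `|f x| <= opnorm f * `|x|.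
Proof.
have [->|x0] := eqVneq x 0; first by rewrite linear0 !normr0 mulr0.
have nx0 : 0 < `|x| by rewrite normr_gt0.
rewrite -ler_pdivrMr//.
apply: (supremumP _ ball1_ge0 ball1_ub).1; first by exists 0.
exists (`|x|^-1 *: x); rewrite /= ?linearZ/= normrZ normfV normr_id ?mulVf ?gt_eqF//.
by rewrite mulrC.
Qed.

Lemma lt_opnorm c : 0 <= c -> c < opnorm f ->
  exists2 x, `|x| <= 1 & c < `|f x|.
Proof.
move=> c0; apply: contraPP => nc; apply/negP; rewrite -real_leNgt ?ger0_real ?opnorm_ge0//.
apply: opnorm_le => // x x1; rewrite real_leNgt ?ger0_real//.
by apply/negP => h; apply: nc; exists x.
Qed.

Lemma bounded_operator_lipschitz : lipschitz f.
Proof.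
apply/lipschitzP; exists (opnorm f) => [|u v]; first exact: opnorm_ge0.
by rewrite -linearB opnormP.
Qed.

Lemma bounded_operator_Lip0 : Lip0 f.
Proof. by split; [exact: bounded_operator_lipschitz|exact: linear0]. Qed.

Lemma opnorm_lipnorm : opnorm f = lipnorm f.
Proof.
have lf := bounded_operator_lipschitz; apply/eqP; rewrite eq_le; apply/andP; split.
  apply: opnorm_le => x x1; have := lipnormP lf x 0; rewrite linear0 !subr0.
  by move/le_trans; apply; rewrite ler_piMr// lipnorm_ge0.
apply: lipnorm_le => [|u v]; first exact: opnorm_ge0.
by rewrite -linearB opnormP.
Qed.

End Opnorm.

Lemma bounded_operatorD (f g : {linear X -> Y}) :
  bounded_operator f -> bounded_operator g -> bounded_operator (f \+ g).
Proof.
move=> bf bg; apply/bounded_operatorP; exists (opnorm f + opnorm g).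
  by rewrite addr_ge0// opnorm_ge0.
by move=> x; rewrite (le_trans (ler_normD _ _))// mulrDl lerD// opnormP.
Qed.

Lemma lipschitzD f g : lipschitz f -> lipschitz g -> lipschitz (f \+ g).
Proof.
move=> /lipschitzP[M M0 fM] /lipschitzP[N N0 gN]; apply/lipschitzP.
exists (M + N); first exact: addr_ge0.
move=> u v /=; rewrite opprD addrACA (le_trans (ler_normD _ _))// mulrDl.
exact: lerD.
Qed.

Lemma lipnormD_le f g : lipschitz f -> lipschitz g ->
  lipnorm (f \+ g) <= lipnorm f + lipnorm g.
Proof.
move=> lf lg; apply: lipnorm_le => [|u v /=]; first by rewrite addr_ge0 ?lipnorm_ge0.
rewrite opprD addrACA (le_trans (ler_normD _ _))// mulrDl.
by rewrite lerD// lipnormP.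
Qed.

(** Bounded rank-one operators are among the rank-one Lipschitz maps, and the two norms agree on
    bounded operators. *)
Lemma lip_daugavet_center_linear (G : {linear X -> Y}) : bounded_operator G ->
  lip_daugavet_center G -> daugavet_center G.
Proof.
move=> bG [_ dG]; split=> // T bT [y y0 Ty].
rewrite !opnorm_lipnorm//; last exact: bounded_operatorD.
by apply: dG; [exact: bounded_operator_Lip0|exists y => //; rewrite Ty].
Qed.

End Norms.

(** * From the linear to the Lipschitz Daugavet equation *)

Lemma scalar_form0 (K : numFieldType) (V : lmodType K) (f : V -> K) :
  (forall a u v, f (a *: u + v) = a * f u + f v) -> f 0 = 0.
Proof.
by move=> /(_ 1 0 0)/eqP; rewrite scaler0 addr0 mul1r addrC -subr_eq subrr => /eqP.
Qed.

Section LinearToLipschitz.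
Variables (R : realType) (K : numFieldType).
Variables (emb : {rmorphism R -> K}) (re : K -> R).
Hypothesis S : real_scalars emb re.
Context {X Y : completeNormedModType K}.

Lemma norm_emb (r : R) : 0 <= r -> `|emb r| = emb r.
Proof. by move=> r0; rewrite ger0_norm// -(rmorph0 emb) (emb_le S). Qed.

Lemma emb_lt r s : (emb r < emb s) = (r < s).
Proof. by rewrite !lt_neqAle (emb_le S) (inj_eq (can_inj (embK S))). Qed.

(** [linear_slope] is applied to the real part of [h] on the underlying real space, and the real
    form is then complexified. The increment from [v] to [u] is assumed nonnegative so that it
    equals its real part. *)
Lemma scalar_linear_slope (h : X -> K) (u v : X) :
  (forall x y, `|h x - h y| <= `|x - y|) ->
  0 <= h u - h v ->
  exists f : X -> K, [/\ forall a x y, f (a *: x + y) = a * f x + f y,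
    forall x, `|f x| <= `|x|,
    h u - h v <= `|f (u - v)| &
    forall c x, c < re (f x) ->
      exists w t, 0 < t /\ c * t < re (h (w + emb t *: x) - h w)].
Proof.
move=> h1 huv0.
have reB a b : re (a - b) = re a - re b.
  by have := reD S (a - b) b; rewrite subrK; lra.
pose V := restrict_scalars emb X.
have := @linear_slope R V (re \o h) (fun x : X => re `|x|) _ _ u v.
case=> [w z|t z t0|l [llin lN luv lgt]].
- rewrite /= -reB -(emb_le S) (le_trans (re_le_norm S _))// (emb_re S)//.
  by rewrite (le_trans (h1 _ _))// addrAC subrr add0r.
- have -> : t *: z = emb t *: (z : X) by [].
  by rewrite normrZ norm_emb ?ltW// (reZ S).
have [f [flin fl]] := complexify S (l := l : X -> R) llin.
have f0 := scalar_form0 flin.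
exists f; split=> //.
(* Rotating [x] makes the value of [f] a nonnegative real, so the bound on the real part bounds the
   modulus. *)
- move=> x; have [w w1 wf] := exists_phase (f x).
  have wfE : f (w *: x) = `|f x| by have := flin w x 0; rewrite !addr0 f0 addr0 wf.
  rewrite -(emb_re S (normr_ge0 (f x))) -wfE fl.
  apply: (@le_trans _ _ (emb (re `|w *: x|))); first by rewrite (emb_le S) lN.
  by rewrite (emb_re S)// normrZ w1 mul1r.
- rewrite -[leLHS](emb_re S)// reB; apply: le_trans (re_le_norm S _).
  by rewrite (emb_le S) fl.
- move=> c x; rewrite fl => /lgt[w [t [t0 ct]]]; exists w, t; split=> //.
  by rewrite reB.
Qed.

(** |a - 1|^2 <= 2 (1 - re a) <= 4 e^2. This square root is why the slices below are cut at
    [1 - 2 * e ^+ 2]. *)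
Lemma norm_sub1_le_double (e a : K) : 0 <= e -> `|a| <= 1 ->
  1 - 2 * e ^+ 2 <= emb (re a) -> `|a - 1| <= 2 * e.
Proof.
move=> e0 a1 ea; rewrite -(@ler_pXn2r _ 2) ?nnegrE ?mulr_ge0//.
rewrite (le_trans (norm_sub1_le S a1))// rmorphM rmorphB rmorph1 rmorph_nat.
have -> : (2 * e) ^+ 2 = 2 * (1 - (1 - 2 * e ^+ 2)) by ring.
by rewrite ler_pM2l// lerD2l lerN2.
Qed.

Lemma exists_rank_one (f : X -> K) (y : Y) (z : X) :
  (forall a u v, f (a *: u + v) = a * f u + f v) ->
  (forall x, `|f x| <= `|x|) -> y != 0 -> f z != 0 ->
  exists T : {linear X -> Y},
    [/\ bounded_operator T, rank_one T & forall x, T x = f x *: y].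
Proof.
move=> flin f1 y0 fz0.
have Tlin : linear (fun x => f x *: y).
  by move=> a u v; rewrite flin scalerDl scalerA.
pose T : {linear X -> Y} := HB.pack (fun x => f x *: y)
  (GRing.isLinear.Build K X Y _ (fun x => f x *: y) Tlin).
exists T; split=> //.
  by apply/bounded_operatorP; exists `|y| => // x; rewrite normrZ mulrC ler_wpM2l.
exists y => //; apply/seteqP; split=> [_ [x _ <-]|_ [k _ <-]]; first by exists (f x).
exists ((k / f z) *: z) => //; rewrite linearZ /= scalerA divfK//.
Qed.

Variable G : {linear X -> Y}.
Hypothesis bG : bounded_operator G.

(* The point at which [G + f(.)y] almost attains its norm is rotated so that [f x]
   is a nonnegative real. *)
Lemma daugavet_center_slice (f : X -> K) (y : Y) (e : K) (z : X) :
  daugavet_center G -> y != 0 -> 0 < e -> 2 * e ^+ 2 < 1 ->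
  (forall a u v, f (a *: u + v) = a * f u + f v) ->
  (forall x, `|f x| <= `|x|) ->
  (1 - e ^+ 2) * `|z| < `|f z| ->
  exists x, [/\ `|x| <= 1, 1 - 2 * e ^+ 2 < f x &
    opnorm G + (1 - 2 * e ^+ 2) * `|y| < `|G x + f x *: y|].
Proof.
move=> [_ dG] y0 e0 e1 flin f1 fz.
have ny0 : 0 < `|y| by rewrite normr_gt0.
have e20 : 0 < e ^+ 2 by rewrite exprn_gt0.
have fz0 : f z != 0.
  rewrite -normr_gt0 (le_lt_trans _ fz)// mulr_ge0// subr_ge0.
  exact: le_trans (ler_peMl (ltW e20) (ler1n K 2)) (ltW e1).
have f0 := scalar_form0 flin.
have [T [bT rT TE]] := exists_rank_one flin f1 y0 fz0.
have c0 : 0 <= opnorm G + (1 - 2 * e ^+ 2) * `|y|.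
  by rewrite addr_ge0 ?(opnorm_ge0 S bG)// mulr_ge0// subr_ge0 ltW.
have : opnorm G + (1 - 2 * e ^+ 2) * `|y| < opnorm (G \+ T).
  (* The value of [T] at [z] shows that its norm exceeds (1 - e^2) |y|. *)
  rewrite dG// ltrD2l; apply: (@le_lt_trans _ _ ((1 - e ^+ 2) * `|y|)).
    by rewrite ler_pM2r// lerD2l lerN2 (ler_peMl (ltW e20) (ler1n K 2)).
  have nz0 : 0 < `|z|.
    by rewrite normr_gt0; apply: contraNneq fz0 => ->; rewrite f0.
  rewrite -(ltr_pM2r nz0); apply: lt_le_trans (opnormP S bT z).
  by rewrite TE normrZ mulrAC ltr_pM2r.
move=> /(lt_opnorm S (bounded_operatorD S bG bT) c0)[x x1 cx].
have [w w1 wf] := exists_phase (f x).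
have wfE : f (w *: x) = `|f x| by have := flin w x 0; rewrite !addr0 f0 addr0 wf.
exists (w *: x); split.
- by rewrite normrZ w1 mul1r.
(* Since |G x| <= [opnorm G], the term |f x| |y| must exceed (1 - 2 e^2) |y|. *)
- rewrite wfE -(ltr_pM2r ny0) -(ltrD2l (opnorm G)); apply: (lt_le_trans cx).
  rewrite /= TE (le_trans (ler_normD _ _))// normrZ lerD2r.
  by rewrite (le_trans (opnormP S bG x))// ler_piMr// (opnorm_ge0 S bG).
- have GwE : G (w *: x) = w *: G x by rewrite linearZ.
  by move: cx; rewrite /= TE wfE -wf GwE -scalerA -scalerDr normrZ w1 mul1r.
Qed.

(** The slice point [x] makes |G x + f x y| large, whereas |G x + b y| <= m for every difference
    quotient [b] of [h] along [x]. The slice costs 2 e^2 |y|, and replacing [f x] by a suitable [b]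
    costs 4 e |y|. *)
Lemma daugavet_center_increment (h : X -> K) (y : Y) (e m : K) (u v : X) :
  daugavet_center G -> y != 0 -> 0 < e -> 2 * e ^+ 2 < 1 -> 0 <= m ->
  (forall x z, `|h x - h z| <= `|x - z|) ->
  (forall x z, `|G (x - z) + (h x - h z) *: y| <= m * `|x - z|) ->
  (1 - e ^+ 2) * `|u - v| < `|h u - h v| ->
  opnorm G + `|y| <= m + (4 * e + 2 * e ^+ 2) * `|y|.
Proof.
move=> dG y0 e0 e1 m0 h1 hm huv.
have [w w1 wh] := exists_phase (h u - h v).
have w0 : w != 0 by rewrite -normr_gt0 w1.
(* The unit scalar [w] makes the increment of [h] a nonnegative real; [y] is rotated back, so the
   products of increments with the vector are unchanged. *)
pose h' x := w * h x; pose y' := w^-1 *: y.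
have hB' x z : h' x - h' z = w * (h x - h z) by rewrite mulrBr.
have h1' x z : `|h' x - h' z| <= `|x - z| by rewrite hB' normrM w1 mul1r.
have ny' : `|y'| = `|y| by rewrite normrZ normfV w1 invr1 mul1r.
have y0' : y' != 0 by rewrite -normr_gt0 ny' normr_gt0.
have huv' : h' u - h' v = `|h u - h v| by rewrite hB' wh.
have [||f [flin f1 fuv fgt]] := @scalar_linear_slope h' u v; first exact: h1'.
  by rewrite huv'.
have [|x [x1 fx cx]] := @daugavet_center_slice f y' e (u - v) dG y0' e0 e1 flin f1.
  by rewrite (lt_le_trans huv)// -huv'.
have e20 : 0 <= 1 - 2 * e ^+ 2 by rewrite subr_ge0 ltW.
have fx0 : 0 <= f x by rewrite ltW// (le_lt_trans e20).
have [|p [t [t0 pt]]] := fgt (re (1 - 2 * e ^+ 2)) x.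
  by rewrite -emb_lt !(emb_re S).
have et0 : 0 < emb t by rewrite -(rmorph0 emb) emb_lt.
pose b := (h' (p + emb t *: x) - h' p) / emb t.
have tb : emb t * b = h' (p + emb t *: x) - h' p by rewrite mulrC divfK// gt_eqF.
have bx : `|b| <= `|x|.
  rewrite -(ler_pM2l et0) -{1}(gtr0_norm et0) -normrM tb (le_trans (h1' _ _))//.
  by rewrite addrAC subrr add0r normrZ gtr0_norm.
have b1 : `|b - 1| <= 2 * e.
  apply: norm_sub1_le_double; [exact: ltW|exact: le_trans x1|].
  rewrite -[leLHS](emb_re S)// (emb_le S) -(ler_pM2r t0) [leRHS]mulrC.
  by rewrite -(reZ S) tb ltW.
have fx1 : `|f x - 1| <= 2 * e.
  apply: norm_sub1_le_double; [exact: ltW|exact: le_trans x1|].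
  by rewrite (emb_re S)// ltW.
have bm : `|G x + b *: y'| <= m.
  rewrite -(ler_pM2l et0) -{1}(gtr0_norm et0) -normrZ scalerDr scalerA tb hB' scalerA.
  rewrite mulrAC divff// mul1r -linearZ/= [X in G X](_ : _ = p + emb t *: x - p); last first.
    by rewrite addrAC subrr add0r.
  rewrite (le_trans (hm _ _))// addrAC subrr add0r normrZ gtr0_norm// mulrA [m * _]mulrC.
  by rewrite ler_piMr// mulr_ge0// ltW.
(* Both [f x] and [b] lie within [2 * e] of 1. *)
have fb : `|f x - b| <= 4 * e.
  have -> : f x - b = (f x - 1) - (b - 1) by ring.
  have -> : 4 * e = 2 * e + 2 * e by ring.
  by rewrite (le_trans (ler_normB _ _))// lerD.
have -> : (4 * e + 2 * e ^+ 2) * `|y| = 4 * e * `|y| + 2 * e ^+ 2 * `|y| by ring.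
rewrite addrA -lerBlDr.
have -> : opnorm G + `|y| - 2 * e ^+ 2 * `|y| = opnorm G + (1 - 2 * e ^+ 2) * `|y'|.
  by rewrite ny'; ring.
apply: (le_trans (ltW cx)).
have -> : G x + f x *: y' = G x + b *: y' + (f x - b) *: y'.
  by rewrite scalerBl -addrA subrKC.
rewrite (le_trans (ler_normD _ _))// lerD// normrZ ny'.
exact: ler_wpM2r.
Qed.

(** Only the lower bound needs the hypothesis: [T] is normalized as a 1-Lipschitz scalar function
    times a vector of norm [lipnorm T], and the error of [daugavet_center_increment] is made
    arbitrarily small. *)
Lemma daugavet_center_lip : daugavet_center G -> lip_daugavet_center G.
Proof.
move=> dG; split=> [|T [lT T0] [y y0 Ty]]; first exact: (bounded_operator_Lip0 S bG).
have lG := bounded_operator_lipschitz S bG.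
have lGT := lipschitzD lG lT.
apply/eqP; rewrite eq_le (lipnormD_le S)//=.
(* A map of Lipschitz norm 0 vanishing at 0 is zero; it is set apart because the normalization
   divides by [c]. *)
have /predU1P[L0|L0] : (0 == lipnorm T) || (0 < lipnorm T).
  by rewrite -le_eqVlt (lipnorm_ge0 S lT).
  rewrite -L0 addr0 (_ : _ \+ _ = G)//; apply/funext => x /=.
  have := lipnormP S lT x 0; rewrite T0 -L0 mul0r subr0 normr_le0 => /eqP ->.
  by rewrite addr0.
have ny0 : 0 < `|y| by rewrite normr_gt0.
have /choice[k kT] : forall x, exists c, T x = c *: y.
  by move=> x; have [|c _ <-] := Ty (T x); [exists x|exists c].
pose L := lipnorm T.
pose c := L / `|y|.
have c0 : 0 < c by rewrite divr_gt0.
pose y' := c *: y; pose h x := k x / c.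
have ny' : `|y'| = L by rewrite normrZ gtr0_norm// divfK// gt_eqF.
have y'0 : y' != 0 by rewrite -normr_gt0 ny'.
have hT u v : T u - T v = (h u - h v) *: y'.
  by rewrite -mulrBl scalerA divfK ?gt_eqF// scalerBl !kT.
have nhT u v : `|T u - T v| = L * `|h u - h v| by rewrite hT normrZ ny' mulrC.
have h1 u v : `|h u - h v| <= `|u - v|.
  by rewrite -(ler_pM2l L0) -nhT; exact: (lipnormP S).
apply/ler_addgt0Pr => d d0.
(* The summand [2 * d] gives 2 e < 1, and [6 * L] gives 6 e L <= d; the error coefficient 4 e + 2
   e^2 is at most 6 e because e <= 1. *)
pose e := d / (6 * L + 2 * d).
have den0 : 0 < 6 * L + 2 * d by rewrite addr_gt0// mulr_gt0.
have e0 : 0 < e by rewrite divr_gt0.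
have e2 : 2 * e < 1.
  by rewrite mulrA ltr_pdivrMr// mul1r ltrDr mulr_gt0.
have e1 : e <= 1 by rewrite (le_trans _ (ltW e2))// (ler_peMl (ltW e0) (ler1n K 2)).
have e22 : 2 * e ^+ 2 < 1.
  by rewrite (le_lt_trans _ e2)// expr2 mulrA ler_piMr// mulr_ge0// ltW.
have eL : (4 * e + 2 * e ^+ 2) * L <= d.
  have : 4 * e + 2 * e ^+ 2 <= 6 * e.
    have -> : 6 * e = 4 * e + 2 * e * 1 by ring.
    by rewrite lerD2l expr2 mulrA ler_wpM2l// mulr_ge0// ltW.
  move=> /(ler_wpM2r (ltW L0)) /le_trans; apply.
  have -> : 6 * e * L = d * (6 * L) / (6 * L + 2 * d) by rewrite /e; ring.
  by rewrite ler_pdivrMr// ler_pM2l// lerDl mulr_ge0// ltW.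
have [||u [v Tuv]] := lt_lipnorm S lT (c := (1 - e ^+ 2) * L).
- rewrite mulr_ge0 ?(ltW L0)// subr_ge0 (le_trans _ (ltW e22))//.
  by rewrite (ler_peMl (exprn_ge0 2 (ltW e0)) (ler1n K 2)).
- by rewrite gtr_pMl// ltrBlDr ltrDl exprn_gt0.
have huv : (1 - e ^+ 2) * `|u - v| < `|h u - h v|.
  by rewrite -(ltr_pM2l L0) -nhT mulrCA mulrA.
have GTuv x z : `|G (x - z) + (h x - h z) *: y'| <= lipnorm (G \+ T) * `|x - z|.
  rewrite -hT; have := lipnormP S lGT x z.
  by rewrite /= opprD addrACA -linearB.
have := daugavet_center_increment dG y'0 e0 e22 (lipnorm_ge0 S lGT) h1 GTuv huv.
rewrite ny' (opnorm_lipnorm S bG) => /le_trans; apply.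
by rewrite lerD2l.
Qed.

End LinearToLipschitz.

Theorem mainTheorem5 (R : realType) (K : numFieldType)
    (hK : real_or_complex R K) (X Y : completeNormedModType K)
    (G : {linear X -> Y}) (hG : bounded_operator G) :
  daugavet_center G <-> lip_daugavet_center G.
Proof.
have [emb [re S]] : exists (emb : {rmorphism R -> K}) (re : K -> R), real_scalars emb re.
  move: hK => [E|E]; subst K.
    by eexists; eexists; exact: real_scalars_id.
  by eexists; eexists; exact: real_scalars_complex.
split; first exact: (daugavet_center_lip S).
exact: (lip_daugavet_center_linear S).
Qed.
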